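(* Let $A\in\mathbb{C}^{n\times n}$ have distinct eigenvalues $\lambda_1,\dots,\lambda_r$ and Jordan canonical form $$\bigoplus_{j=1}^r \bigoplus_{i=1}^{k_j} J_{n_{j,i}}(\lambda_j),\qquad n_{j,1}\geq n_{j,2}\geq\cdots\geq n_{j,k_j},\quad j=1,\dots,r.$$ Then for generic $u,v\in\mathbb{C}^n$ and all $\tau\in\mathbb{C}\setminus\{0\}$ the sizes of the Jordan blocks of $A+\tau uv^\top$ corresponding to the eigenvalue $\lambda_j$ are $n_{j,2}\geq\dots\geq n_{j,k_j}$, for $j=1,\dots,r$ (when $k_j=1$ this list is empty, meaning that $\lambda_j$ is not an eigenvalue of $A+\tau uv^\top$).
   Context: $J_k(\lambda)$ denotes the $k\times k$ Jordan block with eigenvalue $\lambda$. A subset $\Omega\subseteq\mathbb{C}^N$ is called generic if $\Omega$ is nonempty and its complement $\mathbb{C}^N\setminus\Omega$ is contained in a (complex) algebraic set which is not $\mathbb{C}^N$. The phrase ''Let $A\in\mathbb{C}^{n\times n}$. Then for generic $u,v\in\mathbb{C}^n$ ...'' means: for every $A\in\mathbb{C}^{n\times n}$ there exists a generic subset $\Omega$ of $\mathbb{C}^{2n}$, possibly dependent on $A$, such that for all $(u,v)\in\Omega$ the stated property holds. In particular $\Omega$ does not depend on $\tau$. *)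

(* Defs.v *)
From mathcomp Require Import all_boot all_order all_algebra.
From mathcomp Require Import reals complex mpoly.

Set Implicit Arguments.
Unset Strict Implicit.
Unset Printing Implicit Defensive.

Import GRing.Theory.
Local Open Scope ring_scope.

Section JordanForm.
Variable F : fieldType.

Definition jordan_block (k : nat) (l : F) : 'M[F]_k :=
  \matrix_(i < k, j < k)
    (if j == i :> nat then l else if j == i.+1 :> nat then 1 else 0).

(* A list of blocks is given by the pairs (size, eigenvalue). *)
Definition jordan_dim (bs : seq (nat * F)) : nat := sumn [seq b.1 | b <- bs].

(* The direct sum of the blocks, in the order of the list. *)
Fixpoint jordan_mx (bs : seq (nat * F)) : 'M[F]_(jordan_dim bs) :=
  match bs return 'M[F]_(jordan_dim bs) with
  | [::] => 0
  | b :: bs' => block_mx (jordan_block b.1 b.2) 0 0 (jordan_mx bs')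
  end.

(* The cast is needed because the direct sum of the blocks lives in dimension *)
(* jordan_dim bs, which is only propositionally equal to n.                   *)
Definition has_jordan_form (n : nat) (M : 'M[F]_n) (bs : seq (nat * F)) : Prop :=
  all (fun b => (0 < b.1)%N) bs /\
  exists e : jordan_dim bs = n,
    M ~_{in unitmx} (castmx (e, e) (jordan_mx bs)).

(* s lists, up to order and with multiplicities, the sizes of the Jordan      *)
(* blocks of M with eigenvalue l.                                             *)
Definition jordan_sizes (n : nat) (M : 'M[F]_n) (l : F) (s : seq nat) : Prop :=
  exists2 bs, has_jordan_form M bs
            & perm_eq [seq b.1 | b <- bs & b.2 == l] s.

End JordanForm.

Section Generic.
Variables (F : fieldType) (N : nat).

Definition algebraic_subset (Z : 'cV[F]_N -> Prop) : Prop :=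
  exists S : seq {mpoly F[N]}, forall x : 'cV[F]_N,
    Z x <-> (forall p, p \in S -> p.@[fun i => x i 0] = 0).

Definition generic (Omega : 'cV[F]_N -> Prop) : Prop :=
  (exists x, Omega x) /\
  exists Z, [/\ algebraic_subset Z,
                exists x, ~ Z x
              & forall x, ~ Omega x -> Z x].

End Generic.

(* Main.v *)
Require Import Defs.
From mathcomp Require Import all_boot all_order all_algebra.
From mathcomp Require Import reals complex mpoly.
From mathcomp Require Import perm zify.
Set Implicit Arguments.
Unset Strict Implicit.
Unset Printing Implicit Defensive.
Import GRing.Theory.
Local Open Scope ring_scope.

(** Fix an eigenvalue l of A, put N = A - l, and let d be the size of its
    largest Jordan block, so that the left kernels of N^d and N^(d+1) agree.
    Row vectors act on the left throughout.  Let G be the projection onto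
    ker N^d along the image of N^d; it commutes with N.  The matrix
    Q = G N^(d-1) is nonzero, and the genericity condition attached to l is
    v^T Q u != 0, a bilinear condition that does not involve tau.

    Under this condition put B = N + tau u v^T with tau != 0, and let K be the
    space of those x in ker N^d with x N^j u = 0 for all j.  On K the
    perturbation is invisible: B and N coincide there.  Conversely every vector
    of the generalized kernel of B lies in K.  Indeed, if x B is in K,
    multiplying x N + tau (x u) v^T = x B by N^(d-1) G u on the right kills
    both x N and x B, so tau (x u) (v^T Q u) = 0 and x u = 0, from which x is
    in K ([core_perturbed]).  Hence the left kernel of B^p consists of the x in
    ker N^p annihilated by N^j u for j < p.  When p <= d these p conditions
    are independent on ker N^p, because their values on the chain generated by
    v^T G form an anti-triangular Gram matrix with v^T Q u on its antidiagonal.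
    So passing from N^p to B^p raises the rank by exactly min(p, d)
    ([rank_perturbed_exp]).

    In terms of Jordan forms, the nullity of (M - l)^p is the sum of min(p, s)
    over the sizes s of the blocks at l ([rank_jordan_form]), and these sums
    determine the sizes ([perm_eq_sum_minn]).  The rank formula therefore says
    that one block of size d disappears and the others are unchanged.

    The perturbed matrix must be known to have a Jordan form, and the same
    tools give its existence over a closed field ([jordan_form_exists]): with
    d the index of an eigenvalue, a chain e, e N, ..., e N^(d-1) with
    e N^(d-1) f != 0 and f in the image of G spans a Jordan block, and the left
    annihilator of f, N f, ..., N^(d-1) f is an invariant complement.

    Finally, each bilinear condition is the nonvanishing of a nonzero
    polynomial, and a product of finitely many of these defines the proper
    algebraic set to be avoided ([generic_nonvanishing]). *)

(** * Powers, stable kernels and the Fitting projection *)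

Section Fitting.
Variables (F : fieldType) (n : nat).
Implicit Types (N : 'M[F]_n) (d : nat).

Lemma mulmx_expS m (x : 'M[F]_(m, n)) N k :
  x *m N ^+ k.+1 = x *m N *m N ^+ k.
Proof. by rewrite exprS -mulmxE mulmxA. Qed.

Lemma mulmx_expD m (x : 'M[F]_(m, n)) N j k :
  x *m N ^+ (j + k) = x *m N ^+ j *m N ^+ k.
Proof. by rewrite exprD -mulmxE mulmxA. Qed.

Lemma ker_exp_le m (x : 'M[F]_(m, n)) N j k :
  (j <= k)%N -> x *m N ^+ j = 0 -> x *m N ^+ k = 0.
Proof. by move=> /subnKC <-; rewrite mulmx_expD => ->; rewrite mul0mx. Qed.

(** Once two consecutive powers have the same rank, kernels of powers stop
    growing. *)
Lemma ker_exp_stable N d m (x : 'M[F]_(m, n)) k :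
  \rank (N ^+ d.+1) = \rank (N ^+ d) -> x *m N ^+ k = 0 -> x *m N ^+ d = 0.
Proof.
move=> stab; have step (y : 'M[F]_(m, n)) :
    y *m N ^+ d.+1 = 0 -> y *m N ^+ d = 0.
  have sub : (kermx (N ^+ d) <= kermx (N ^+ d.+1))%MS.
    by apply/sub_kermxP; apply: ker_exp_le (mulmx_ker _).
  have [_] := mxrank_leqif_sup sub; rewrite !mxrank_ker stab eqxx => /esym sub'.
  move=> /sub_kermxP y0; apply/sub_kermxP; exact: submx_trans y0 sub'.
elim: k x => [|k IHk] x; first by rewrite expr0 mulmx1 => ->; rewrite mul0mx.
by rewrite mulmx_expS => /IHk; rewrite -mulmx_expS; apply: step.
Qed.

(** The space splits as ker N^d plus the image of N^d as soon as the rank of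
    N^d is stable; both summands are invariant, so the projection G onto the
    first one commutes with N. *)
Lemma fitting_projection N d :
    \rank (N ^+ d.+1) = \rank (N ^+ d) ->
  exists G : 'M[F]_n, [/\ G *m N = N *m G, G *m N ^+ d = 0
    & forall m (y : 'M[F]_(m, n)), y *m N ^+ d = 0 -> y *m G = y].
Proof.
move=> stab; set U := kermx (N ^+ d); set V := N ^+ d.
have UV0 : (U :&: V)%MS = 0.
  apply/eqP; rewrite -submx0; apply/rV_subP => x; rewrite sub_capmx.
  case/andP=> /sub_kermxP xU /submxP [y xy]; rewrite submx0.
  apply/eqP; rewrite xy; apply: (ker_exp_stable stab (k := d + d)).
  by rewrite mulmx_expD -xy.
have UV1 m (W : 'M[F]_(m, n)) : (W <= U + V)%MS.
  apply: submx_full; rewrite /row_full mxrank_disjoint_sum // mxrank_ker.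
  by rewrite subnK // rank_leq_row.
have id_ker m (y : 'M[F]_(m, n)) : y *m N ^+ d = 0 -> y *m proj_mx U V = y.
  by move=> /sub_kermxP yU; apply: proj_mx_id.
have GN0 : proj_mx U V *m N ^+ d = 0.
  by apply/sub_kermxP; rewrite -[X in (X <= _)%MS]mul1mx; apply: proj_mx_sub.
exists (proj_mx U V); split => //.
(* Expand 1 = G + G', where G' projects onto the image, in 1 N G. *)
have /= dec := add_proj_mx UV0 (UV1 _ 1%:M); rewrite !mul1mx in dec.
rewrite -[RHS]mul1mx -[in RHS]dec mulmxDl !(mulmxA _ N).
rewrite id_ker ?[X in _ + X]proj_mx_0 ?addr0 //.
  have /submxP [D ->] : (proj_mx V U <= V)%MS.
    by rewrite -[X in (X <= _)%MS]mul1mx; apply: proj_mx_sub.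
  apply/submxP; exists (D *m N).
  by rewrite -!mulmxA; congr (_ *m _); rewrite mulmxE -exprS -exprSr.
by rewrite -mulmx_expS exprSr -mulmxE mulmxA GN0 mul0mx.
Qed.

Lemma ker_exp_strict N d :
    (\rank (N ^+ d.+1) < \rank (N ^+ d))%N ->
  exists2 e : 'rV[F]_n, e *m N ^+ d.+1 = 0 & e *m N ^+ d != 0.
Proof.
move=> lt_rank.
have : ~~ (kermx (N ^+ d.+1) <= kermx (N ^+ d))%MS.
  apply: contraL lt_rank => /mxrankS; rewrite !mxrank_ker -leqNgt.
  have := rank_leq_row (N ^+ d); have := rank_leq_row (N ^+ d.+1); lia.
case/row_subPn=> i; rewrite sub_kermx => nz; exists (row i (kermx (N ^+ d.+1))) => //.
by rewrite -row_mul mulmx_ker row0.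
Qed.

End Fitting.

(** * Krylov matrices *)

Section Krylov.
Variables (F : fieldType) (n : nat).
Implicit Types (N : 'M[F]_n) (e : 'rV[F]_n) (f : 'cV[F]_n).

Definition krylov_rows N e p : 'M[F]_(p, n) :=
  \matrix_(i < p, j < n) (e *m N ^+ i) 0 j.

Definition krylov_cols N f p : 'M[F]_(n, p) :=
  \matrix_(i < n, j < p) (N ^+ j *m f) i 0.

Lemma row_krylov N e p i : row i (krylov_rows N e p) = e *m N ^+ i.
Proof. by apply/rowP => j; rewrite !mxE. Qed.

Lemma col_krylov N f p j : col j (krylov_cols N f p) = N ^+ j *m f.
Proof. by apply/colP => i; rewrite !mxE. Qed.

Lemma krylov_cols_ker N f p m (x : 'M[F]_(m, n)) :
  x *m krylov_cols N f p = 0 <-> forall j, (j < p)%N -> x *m N ^+ j *m f = 0.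
Proof.
split=> [x0 j jp | x0].
  by rewrite -mulmxA -(col_krylov N f (Ordinal jp)) colE mulmxA x0 mul0mx.
apply/matrixP => i j; have := x0 j (ltn_ord j); rewrite -mulmxA -col_krylov colE mulmxA -colE.
by move/colP/(_ i); rewrite !mxE.
Qed.

Lemma krylov_ker_cols N f p m (x : 'M[F]_(m, n)) :
  x *m krylov_cols N f p = 0 -> N ^+ p *m f = 0 ->
  x *m N *m krylov_cols N f p = 0.
Proof.
move=> /krylov_cols_ker x0 f0; apply/krylov_cols_ker => j jp.
rewrite -mulmx_expS; have [jp1|] := ltnP j.+1 p; first exact: x0.
move=> pj; have -> : j.+1 = p by lia.
by rewrite -mulmxA f0 mulmx0.
Qed.

(** Only i + j matters in the (i, j) entry: the Gram matrix is a Hankel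
    matrix. *)
Lemma krylov_gramE N e f p q :
  krylov_rows N e p *m krylov_cols N f q
  = \matrix_(i, j) (e *m N ^+ (i + j) *m f) 0 0.
Proof.
apply/matrixP => i j; rewrite [RHS]mxE mulmx_expD -[in RHS]mulmxA.
rewrite -(row_krylov N e i) -(col_krylov N f j) !mxE.
by apply: eq_bigr => k _; rewrite !mxE.
Qed.

(** Under the hypotheses the Hankel matrix vanishes strictly below its
    antidiagonal and is a nonzero constant on it; reversing the rows makes it
    triangular. *)
Lemma krylov_gram_unit N e f p :
    (forall k, (p <= k)%N -> e *m N ^+ k *m f = 0) ->
    e *m N ^+ p.-1 *m f != 0 ->
  krylov_rows N e p *m krylov_cols N f p \in unitmx.
Proof.
move=> h0 hn0; rewrite krylov_gramE; set H := matrix_of_fun _ _.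
have scalar0 (c : 'M[F]_1) : (c == 0) = (c 0 0 == 0).
  by apply/eqP/eqP => [->|c0]; rewrite ?mxE // [c]mx11_scalar c0 raddf0.
suff: row_perm (perm rev_ord_inj) H \in unitmx.
  by rewrite row_permE unitmx_mul unitmx_perm.
rewrite unitmxE det_trig; last first.
  apply/is_trig_mxP => i j ij; rewrite [LHS]mxE permE [LHS]mxE /= h0 ?[LHS]mxE //.
  by have := ltn_ord i; lia.
rewrite unitfE; apply/prodf_neq0 => i _; rewrite [X in X != _]mxE permE [X in X != _]mxE /=.
have -> : (p - i.+1 + i)%N = p.-1 by have := ltn_ord i; lia.
by rewrite -scalar0.
Qed.

End Krylov.

(** * The generalized kernel after a rank one perturbation *)

Section RankOne.
Variables (F : fieldType) (n : nat) (N G : 'M[F]_n) (d : nat).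
Hypothesis stab : \rank (N ^+ d.+1) = \rank (N ^+ d).
Hypothesis GN : G *m N = N *m G.
Hypothesis GNd : G *m N ^+ d = 0.
Hypothesis Gid : forall m (y : 'M[F]_(m, n)), y *m N ^+ d = 0 -> y *m G = y.
Variables u v : 'cV[F]_n.
Hypothesis uv : v^T *m (G *m N ^+ d.-1) *m u != 0.
Variable tau : F.
Hypothesis tau0 : tau != 0.
Let B := N + tau *: (u *m v^T).

Lemma comm_exp_proj k : N ^+ k *m G = G *m N ^+ k.
Proof.
elim: k => [|k IHk]; first by rewrite expr0 mulmx1 mul1mx.
by rewrite mulmx_expS exprS -mulmxE -mulmxA IHk GN -!mulmxA mulmxE !mulrA.
Qed.

(** The space K on which N and its perturbation B act in the same way; it turns
    out to be the whole generalized kernel of B. *)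
Definition in_core (x : 'rV[F]_n) : Prop :=
  x *m N ^+ d = 0 /\ forall j, x *m N ^+ j *m u = 0.

Lemma perturbedE (x : 'rV[F]_n) : x *m u = 0 -> x *m B = x *m N.
Proof. by move=> xu; rewrite mulmxDr -scalemxAr mulmxA xu mul0mx scaler0 addr0. Qed.

(** This is where genericity enters: multiplying the identity
    x B = x N + tau (x u) v^T by G N^(d-1) u leaves only the multiple
    tau (x u) of the nonzero scalar [uv], so x u = 0. *)
Lemma core_perturbed (x : 'rV[F]_n) : in_core (x *m B) -> in_core x.
Proof.
move=> [y1 y2].
have d0 : (0 < d)%N.
  (* For d = 0 the projection is zero, against [uv]. *)
  case: (d) GNd uv => // G0; rewrite expr0 mulmx1 in G0 *.
  by rewrite G0 mulmx0 mul0mx eqxx.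
have xu : x *m u = 0.
  have : x *m B *m (G *m N ^+ d.-1) *m u = 0 by rewrite mulmxA Gid.
  rewrite mulmxDr !mulmxDl.
  have -> : x *m N *m (G *m N ^+ d.-1) = 0.
    rewrite !mulmxA -(mulmxA x) -GN -!mulmxA mulmxE -exprS prednK //.
    by rewrite -mulmxE GNd mulmx0.
  rewrite mul0mx add0r -scalemxAr mulmxA -!scalemxAl -!mulmxA.
  rewrite (mulmxA x u).
  have [a ->] : exists a, x *m u = a%:M.
    by exists ((x *m u) 0 0); apply: mx11_scalar.
  rewrite mul_scalar_mx scalerA => /eqP; rewrite scaler_eq0 mulf_eq0 (negPf tau0) /=.
  rewrite (mulmxA G) mulmxA (negPf uv) orbF => /eqP ->; exact: raddf0.
rewrite perturbedE // in y1 y2; split.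
  by apply: (ker_exp_stable stab (k := d.+1)); rewrite mulmx_expS.
by case=> [|j]; rewrite ?expr0 ?mulmx1 // mulmx_expS.
Qed.

Lemma core_of_ker_perturbed p (x : 'rV[F]_n) : x *m B ^+ p = 0 -> in_core x.
Proof.
elim: p x => [|p IHp] x; last by rewrite mulmx_expS => /IHp /core_perturbed.
by rewrite expr0 mulmx1 => ->; split=> *; rewrite !mul0mx.
Qed.

Lemma core_perturbedE p (x : 'rV[F]_n) : in_core x -> x *m B ^+ p = x *m N ^+ p.
Proof.
elim: p x => [|p IHp] x [x1 x2]; first by rewrite !expr0.
have xu : x *m u = 0 by have := x2 0; rewrite expr0 mulmx1.
rewrite !mulmx_expS perturbedE // IHp //; split=> [|j].
  by rewrite -mulmx_expS; apply: ker_exp_le x1.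
by rewrite -mulmx_expS.
Qed.

(** The bound p <= d makes the p conditions x N^j u = 0 with j < p suffice:
    for j >= p they follow from x N^p = 0. *)
Lemma ker_perturbed_exp p (x : 'rV[F]_n) :
  (p <= d)%N ->
  x *m B ^+ p = 0 <-> x *m N ^+ p = 0 /\ x *m krylov_cols N u p = 0.
Proof.
move=> pd; rewrite krylov_cols_ker; split=> [x0 | [x0 xu]].
  have core := core_of_ker_perturbed x0; rewrite -core_perturbedE // x0.
  by case: core => _ xu; split.
rewrite core_perturbedE //; split=> [|j]; first exact: ker_exp_le x0.
have [/xu //|pj] := ltnP j p.
by rewrite (ker_exp_le pj x0) mul0mx.
Qed.

(** The conditions x N^j u = 0, for j < p, are independent on ker N^p: they are
    tested on the last p vectors of the chain of length d generated by
    v^T G. *)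
Lemma rank_krylov_ker p :
  (p <= d)%N -> \rank (kermx (N ^+ p) *m krylov_cols N u p) = p.
Proof.
move=> pd; apply/eqP; rewrite eqn_leq rank_leq_col /=.
case: p pd => // p pd.
pose W := krylov_rows N (v^T *m G *m N ^+ (d - p.+1)) p.+1.
have unitWY : W *m krylov_cols N u p.+1 \in unitmx.
  apply: krylov_gram_unit => [k pk|].
    rewrite -mulmx_expD (@ker_exp_le _ _ _ _ _ d) ?mul0mx //; first by lia.
    by rewrite -mulmxA GNd mulmx0.
  rewrite -mulmx_expD -(mulmxA v^T).
  by have -> : (d - p.+1 + p.+1.-1)%N = d.-1 by lia.
rewrite -[X in (X <= _)%N](mxrank_unit unitWY).
apply/mxrankS/submxMr/sub_kermxP/row_matrixP => i.
rewrite row_mul row_krylov row0 -!mulmx_expD (@ker_exp_le _ _ _ _ _ d) //; first by lia.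
by rewrite -mulmxA GNd mulmx0.
Qed.

Lemma rank_perturbed_exp p : \rank (B ^+ p) = (\rank (N ^+ p) + minn p d)%N.
Proof.
have small q : (q <= d)%N -> \rank (B ^+ q) = (\rank (N ^+ q) + q)%N.
  move=> qd; have kerB :
      (kermx (B ^+ q) :=: kermx (N ^+ q) :&: kermx (krylov_cols N u q))%MS.
    apply/eqmxP; apply/andP; split; apply/rV_subP => x.
      move/sub_kermxP/(ker_perturbed_exp _ qd) => [x1 x2].
      by rewrite sub_capmx; apply/andP; split; apply/sub_kermxP.
    rewrite sub_capmx => /andP [/sub_kermxP x1 /sub_kermxP x2].
    by apply/sub_kermxP/ker_perturbed_exp.
  have := mxrank_mul_ker (kermx (N ^+ q)) (krylov_cols N u q).
  rewrite -kerB rank_krylov_ker // !mxrank_ker.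
  by have := rank_leq_row (B ^+ q); have := rank_leq_row (N ^+ q); lia.
(* Beyond d both ranks are stationary. *)
have [pd|dp] := leqP p d; first exact: small.
have same (M : 'M[F]_n) : 
    (forall x : 'rV_n, x *m M ^+ p = 0 -> x *m M ^+ d = 0) ->
    \rank (M ^+ p) = \rank (M ^+ d).
  move=> sub; suff : (kermx (M ^+ p) :=: kermx (M ^+ d))%MS.
    move=> eqk; have := eqk.1; rewrite !mxrank_ker.
    by have := rank_leq_row (M ^+ p); have := rank_leq_row (M ^+ d); lia.
  apply/eqmxP; apply/andP; split; apply/rV_subP => x /sub_kermxP x0; apply/sub_kermxP.
    exact: sub.
  exact: ker_exp_le (ltnW dp) x0.
rewrite !same ?small // => x; first exact: ker_exp_stable.
move=> x0; have core := core_of_ker_perturbed x0.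
by rewrite core_perturbedE //; case: core.
Qed.

End RankOne.

(** * Ranks of powers and Jordan block sizes *)

Section JordanBlocks.
Variable F : fieldType.

(** A rectangular intertwiner lets Jordan forms be assembled block by block
    without casts; the equality of dimensions is recovered from the ranks. *)
Lemma has_jordan_form_intertwined n (A : 'M[F]_n) bs
    (P : 'M[F]_(jordan_dim bs, n)) :
    all (fun b => 0 < b.1)%N bs -> row_free P -> row_full P ->
    P *m A = jordan_mx bs *m P ->
  has_jordan_form A bs.
Proof.
move=> bs0 freeP fullP PA; split=> //.
have e : jordan_dim bs = n by move/eqP: freeP => <-; exact/eqP.
exists e; move: (jordan_mx bs) P freeP fullP PA e.
move: (jordan_dim bs) => k J P freeP _ PA e; subst k; rewrite castmx_id.
have Pu : P \in unitmx by rewrite -row_free_unit.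
by exists P => //; apply/simmxP.
Qed.

Lemma rank_block_exp n1 n2 (A : 'M[F]_n1) (B : 'M[F]_n2) p :
  \rank (block_mx A 0 0 B ^+ p) = (\rank (A ^+ p) + \rank (B ^+ p))%N.
Proof.
suff -> : block_mx A 0 0 B ^+ p = block_mx (A ^+ p) 0 0 (B ^+ p).
  exact: rank_diag_block_mx.
elim: p => [|p IHp]; first by rewrite !expr0 -scalar_mx_block.
by rewrite !exprS IHp -!mulmxE mulmx_block !(mulmx0, mul0mx, addr0, add0r).
Qed.

Lemma jordan_block_shift k (l m : F) :
  jordan_block k l - m%:M = jordan_block k (l - m).
Proof.
apply/matrixP => i j; rewrite !mxE eq_sym -val_eqE /=.
by case: eqP => // _; rewrite ?mulr1n // mulr0n subr0.
Qed.

Lemma unitmx_exp k (M : 'M[F]_k) p : M \in unitmx -> M ^+ p \in unitmx.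
Proof.
move=> Mu; elim: p => [|p IHp]; first by rewrite expr0 unitmx1.
by rewrite exprS -mulmxE unitmx_mul Mu.
Qed.

Lemma jordan_block_unit k (l : F) : l != 0 -> jordan_block k l \in unitmx.
Proof.
move=> l0; rewrite -unitmx_tr unitmxE det_trig; last first.
  by apply/is_trig_mxP => i j ij; rewrite !mxE !ltn_eqF // ltnW.
by rewrite unitfE; apply/prodf_neq0 => i _; rewrite !mxE eqxx.
Qed.

Lemma jordan_block0_exp k p :
  jordan_block k 0 ^+ p
  = \matrix_(i < k, j < k) (j == (i + p)%N :> nat)%:R :> 'M[F]_k.
Proof.
elim: p => [|p IHp].
  by apply/matrixP => i j; rewrite expr0 !mxE addn0 eq_sym.
apply/matrixP => i j; rewrite exprS IHp -mulmxE !mxE.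
have [ik|ki] := ltnP i.+1 k.
  rewrite (bigD1 (Ordinal ik)) //= !mxE /= eqxx ifF; last by lia.
  rewrite mul1r addSnnS big1 ?addr0 // => a; rewrite -val_eqE /= => ai.
  by rewrite !mxE (negPf ai) if_same mul0r.
rewrite big1 => [|a _].
  have -> // : (j == (i + p.+1)%N :> nat) = false by have := ltn_ord j; lia.
rewrite !mxE; have -> : (a == i.+1 :> nat) = false by have := ltn_ord a; lia.
by rewrite if_same mul0r.
Qed.

(** The p-th power of the nilpotent block factors as the selection of its first
    k - p rows followed by a shift matrix with orthonormal rows. *)
Lemma rank_jordan_block0_exp k p :
  \rank (jordan_block k (0 : F) ^+ p) = (k - p)%N.
Proof.
pose S : 'M[F]_(k - p, k) := \matrix_(i, j) (j == (i + p)%N :> nat)%:R.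
have -> : jordan_block k (0 : F) ^+ p
    = (pid_mx (k - p) : 'M_(k, k - p)) *m S.
  rewrite jordan_block0_exp; apply/matrixP => i j; rewrite !mxE.
  have [ik|ki] := ltnP i (k - p).
    rewrite (bigD1 (Ordinal ik)) //= !mxE /= eqxx ik mul1r big1 ?addr0 // => a.
    by rewrite -val_eqE /= eq_sym => /negPf ai; rewrite !mxE ai mul0r.
  rewrite big1 => [|a _].
    have -> // : (j == (i + p)%N :> nat) = false by have := ltn_ord j; lia.
  by rewrite !mxE [(i < _)%N]ltnNge ki andbF mul0r.
rewrite mxrankMfree ?rank_pid_mx ?leq_subr //.
apply/row_freeP; exists S^T; apply/matrixP => i j; rewrite !mxE.
have ik : (i + p < k)%N by have := ltn_ord i; lia.
rewrite (bigD1 (Ordinal ik)) //= !mxE /= eqxx mul1r eqn_add2r big1 ?addr0 // => a.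
by rewrite -val_eqE /= => /negPf ai; rewrite !mxE ai mul0r.
Qed.

(** A block at l loses min(p, size) in rank when the p-th power is taken, and
    the blocks at other eigenvalues stay invertible. *)
Lemma rank_jordan_mx bs (l : F) p :
  (\rank ((jordan_mx bs - l%:M) ^+ p)
     + \sum_(b <- bs | b.2 == l) minn p b.1 = jordan_dim bs)%N.
Proof.
elim: bs => [|[k m] bs IHbs] /=.
  by rewrite big_nil flatmx0 mxrank0.
rewrite (scalar_mx_block k (jordan_dim bs)).
rewrite opp_block_mx add_block_mx.
rewrite !oppr0 !addr0 rank_block_exp big_cons /= jordan_block_shift.
have -> : jordan_dim ((k, m) :: bs) = (k + jordan_dim bs)%N by [].
have rank_block : (\rank (jordan_block k (m - l) ^+ p)
    + (if m == l then minn p k else 0) = k)%N.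
  have [->|ml] := eqVneq m l; first by rewrite subrr rank_jordan_block0_exp; lia.
  rewrite addn0 mxrank_unit // unitmx_exp // jordan_block_unit //.
  by rewrite subr_eq0.
case: ifP rank_block => _ rank_block; first by rewrite addnACA rank_block IHbs.
by rewrite addn0 in rank_block; rewrite -addnA rank_block IHbs.
Qed.

Lemma rank_jordan_form n (A : 'M[F]_n) bs (l : F) p :
  has_jordan_form A bs ->
  (\rank ((A - l%:M) ^+ p) + \sum_(b <- bs | b.2 == l) minn p b.1 = n)%N.
Proof.
case=> _ []; have := rank_jordan_mx bs l p.
move: (jordan_mx bs); move: (jordan_dim bs) => k J rankJ e; subst k.
rewrite castmx_id => -[P Pu /(simmxP Pu) PA]; rewrite -[RHS]rankJ; congr (_ + _)%N.
suff PAp : P *m (A - l%:M) ^+ p = (J - l%:M) ^+ p *m P.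
  have freeP : row_free P by rewrite row_free_unit.
  have fullP : row_full P by rewrite row_full_unit.
  by rewrite -(mxrankMfree ((J - _) ^+ p) freeP) -PAp (eqmxMfull _ fullP).
elim: p {rankJ} => [|p IHp]; first by rewrite !expr0 mulmx1 mul1mx.
rewrite exprSr [in RHS]exprSr -!mulmxE mulmxA IHp -!mulmxA; congr (_ *m _).
by rewrite mulmxBr mulmxBl PA scalar_mxC.
Qed.

End JordanBlocks.

(** Successive differences of the sums of min(p, m) count the entries exceeding
    p: this is the conjugate partition. *)
Lemma count_ltn_minn (s : seq nat) p :
  (\sum_(m <- s) minn p m + count (ltn p) s = \sum_(m <- s) minn p.+1 m)%N.
Proof. by elim: s => [|m s IHs]; rewrite ?big_nil //= !big_cons -IHs; lia. Qed.

Lemma perm_eq_sum_minn (s t : seq nat) :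
    all (ltn 0) s -> all (ltn 0) t ->
    (forall p, \sum_(m <- s) minn p m = \sum_(m <- t) minn p m)%N ->
  perm_eq s t.
Proof.
move=> s0 t0 st; have cnt p : count (ltn p) s = count (ltn p) t.
  by have := count_ltn_minn s p; have := count_ltn_minn t p; rewrite !st; lia.
have count_memE x (r : seq nat) :
    (count_mem x.+1 r + count (ltn x.+1) r = count (ltn x) r)%N.
  by elim: r => //= m r <-; lia.
apply/allP => x _ /=; apply/eqP; case: x => [|x].
  have no0 (r : seq nat) : all (ltn 0) r -> count_mem 0%N r = 0%N.
    by elim: r => //= m r IHr /andP [m0 /IHr ->]; lia.
  by rewrite !no0.
by apply: (@addIn (count (ltn x.+1) t)); rewrite -{1}cnt !count_memE cnt.
Qed.

(** * Existence of Jordan forms *)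

Section JordanSplit.
Variables (F : fieldType) (n : nat).

(** The ranks of the powers decrease strictly until they become stationary, and
    a singular matrix makes at least one strict step. *)
Lemma rank_exp_index (N : 'M[F]_n) : (\rank N < n)%N ->
  exists2 d, \rank (N ^+ d.+2) = \rank (N ^+ d.+1)
           & (\rank (N ^+ d.+1) < \rank (N ^+ d))%N.
Proof.
move=> singN; have mono k : (\rank (N ^+ k.+1) <= \rank (N ^+ k))%N.
  by rewrite exprS -mulmxE mxrankM_maxr.
have ex : exists k, \rank (N ^+ k.+1) == \rank (N ^+ k).
  case: (boolP (has (fun k => \rank (N ^+ k.+1) == \rank (N ^+ k))
                 (iota 0 n.+1))).
    by case/hasP => k _; exists k.
  move=> /hasPn noeq; suff: (\rank (N ^+ n.+1) + n.+1 <= n)%N by lia.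
  elim: {-2}n.+1 (leqnn n.+1) => [|k IHk] kn; first by rewrite addn0 rank_leq_row.
  have := noeq k; rewrite mem_iota kn => /(_ isT).
  by have := mono k; have := IHk (ltnW kn); lia.
have [[|d] /eqP stab dmin] := ex_minnP ex; first by rewrite expr1 expr0 mxrank1 in stab; lia.
exists d => //; rewrite ltn_neqAle mono andbT.
by apply/negP => /dmin; rewrite ltnn.
Qed.

Lemma krylov_rows_jordan (A : 'M[F]_n) (l : F) (e : 'rV[F]_n) d :
    e *m (A - l%:M) ^+ d = 0 ->
  krylov_rows (A - l%:M) e d *m A = jordan_block d l *m krylov_rows (A - l%:M) e d.
Proof.
set N := A - _; set W := krylov_rows _ _ _ => e0.
have WN : W *m N = jordan_block d 0 *m W.
  apply/row_matrixP => i; rewrite !row_mul row_krylov.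
  have -> : e *m N ^+ i *m N = e *m N ^+ i.+1 by rewrite exprSr -mulmxE mulmxA.
  have [id|di] := ltnP i.+1 d.
    rewrite -(row_krylov N e (Ordinal id)) [LHS]rowE; congr (_ *m _); apply/rowP => j.
    rewrite !mxE eqxx /= -val_eqE /=.
    by case: eqP => [->|_]; rewrite ?if_same ?gtn_eqF.
  have -> : row i (jordan_block d 0) = 0 :> 'rV[F]_d.
    by apply/rowP => j; rewrite !mxE (ltn_eqF (leq_trans (ltn_ord j) di)) if_same.
  by rewrite mul0mx (ker_exp_le di).
have -> : A = N + l%:M by rewrite subrK.
have -> : jordan_block d l = jordan_block d 0 + l%:M.
  by rewrite -(subrr l) -jordan_block_shift subrK.
by rewrite mulmxDr mulmxDl WN scalar_mxC.
Qed.

(** A Jordan chain of maximal length splits off.  Its invariant complement is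
    the left annihilator of the columns N^j f: those columns span an invariant
    space because f is killed by N^(d+1), and the annihilator meets the chain
    trivially because the Gram matrix is invertible. *)
Lemma jordan_chain_split (A : 'M[F]_n) (l : F) : eigenvalue A l ->
  exists d m (W : 'M[F]_(d.+1, n)) (V : 'M[F]_(m, n)) (A' : 'M[F]_m),
    [/\ W *m A = jordan_block d.+1 l *m W, V *m A = A' *m V,
        (d.+1 + m = n)%N & \rank (col_mx W V) = n].
Proof.
move=> eigA; set N := A - l%:M.
have singN : (\rank N < n)%N.
  by move: eigA; rewrite /eigenvalue -mxrank_eq0 mxrank_ker subn_eq0 -ltnNge.
have [d stab strict] := rank_exp_index singN.
have [e eN eN0] := ker_exp_strict strict.
have [G [GN GNd Gid]] := fitting_projection stab.
have [i ei] := rV0Pn _ eN0; pose f := G *m delta_mx i 0 : 'cV[F]_n.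
have Nf k : (d < k)%N -> N ^+ k *m f = 0.
  move=> dk; rewrite mulmxA (comm_exp_proj GN) (@ker_exp_le _ _ _ _ _ d.+1) //.
  exact: mul0mx.
have ef : e *m N ^+ d *m f != 0.
  rewrite mulmxA Gid; last first.
    by rewrite -mulmx_expD (ker_exp_le (leq_addl d _)).
  apply: contra ei => /eqP; rewrite -colE => /matrixP/(_ 0 0).
  by rewrite mxE [X in _ = X]mxE => ->.
pose W := krylov_rows N e d.+1; pose Y := krylov_cols N f d.+1.
have WYu : W *m Y \in unitmx.
  by apply: krylov_gram_unit => // k dk; rewrite -mulmxA Nf ?mulmx0.
have rankWY := mxrank_unit WYu.
have rankW : \rank W = d.+1.
  by apply/eqP; rewrite eqn_leq rank_leq_row -{1}rankWY mxrankM_maxl.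
have rankY : \rank Y = d.+1.
  by apply/eqP; rewrite eqn_leq rank_leq_col -{1}rankWY mxrankM_maxr.
pose V := row_base (kermx Y).
have VY0 : V *m Y = 0 by apply/sub_kermxP; rewrite eq_row_base.
have /submxP [A' VA] : (V *m A <= V)%MS.
  rewrite eq_row_base; apply/sub_kermxP.
  have -> : A = N + l%:M by rewrite subrK.
  rewrite mulmxDr mulmxDl krylov_ker_cols ?Nf //.
  by rewrite add0r scalar_mxC -mulmxA VY0 mulmx0.
have dim : (d.+1 + \rank (kermx Y) = n)%N.
  by rewrite mxrank_ker rankY subnKC // -rankY rank_leq_row.
exists d, (\rank (kermx Y)), W, V, A'; split=> //; first exact: krylov_rows_jordan.
rewrite -addsmxE mxrank_disjoint_sum ?rankW ?eq_row_base //.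
apply/eqP; rewrite -submx0; apply/rV_subP => x.
rewrite sub_capmx eq_row_base => /andP [/submxP [c ->] /sub_kermxP].
rewrite -mulmxA => /(congr1 (mulmx^~ (invmx (W *m Y)))).
by rewrite mulmxK // mul0mx => ->; rewrite mul0mx sub0mx.
Qed.

End JordanSplit.

Lemma jordan_form_exists (F : closedFieldType) n (A : 'M[F]_n) :
  exists bs, has_jordan_form A bs.
Proof.
suff [bs [P [bs0 freeP fullP PA]]] : exists bs (P : 'M[F]_(jordan_dim bs, n)),
    [/\ all (fun b => 0 < b.1)%N bs, row_free P, row_full P
      & P *m A = jordan_mx bs *m P].
  by exists bs; apply: has_jordan_form_intertwined PA.
have [k] := ubnP n; elim: k n A => // k IHk [|n] A nk.
  exists [::], 0; split=> //; last by rewrite mulmx0 mul0mx.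
  - by rewrite /row_free mxrank0.
  - by rewrite /row_full mxrank0.
have [l] : exists l, root (char_poly A) l.
  by apply/closed_rootP; rewrite size_char_poly.
rewrite -eigenvalue_root_char.
case/jordan_chain_split => d [m [W [V [A' [WA VA dim rankWV]]]]].
have [|bs [P [bs0 freeP fullP PA']]] := IHk m A'; first by lia.
have dimP : jordan_dim bs = m by move/eqP: freeP => <-; exact/eqP.
exists ((d.+1, l) :: bs), (col_mx W (P *m V)).
have rankP : \rank (col_mx W (P *m V)) = n.+1.
  rewrite -[RHS]rankWV -!addsmxE.
  by apply/eqmx_rank/eqmxP/adds_eqmx => //; apply: eqmxMfull.
split=> //; last first.
- rewrite [LHS]mul_col_mx [RHS]mul_block_col.
  by rewrite !mul0mx addr0 add0r WA -mulmxA VA !mulmxA PA'.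
- by rewrite /row_full rankP.
- by rewrite /row_free rankP /jordan_dim /= -/(jordan_dim bs) dimP dim.
Qed.

(** * The effect on the block sizes *)

Lemma jordan_sizes_nil_eigenvalue (F : fieldType) n (M : 'M[F]_n) l :
  jordan_sizes M l [::] -> ~~ eigenvalue M l.
Proof.
case=> bs jM /perm_nilP bsl; have := rank_jordan_form l 1 jM.
rewrite -big_filter -(big_map fst predT (minn 1)) bsl big_nil addn0 expr1 => rkM.
by rewrite /eigenvalue -mxrank_eq0 mxrank_ker rkM subnn.
Qed.

(** The witness is Q = G N^(m-1): it is nonzero because N^(m-1) does not vanish
    on ker N^m, where G is the identity. *)
Lemma perturbed_jordan_sizes (F : closedFieldType) n (A : 'M[F]_n) l m s :
    jordan_sizes A l (m :: s) -> sorted geq (m :: s) ->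
  exists2 Q : 'M[F]_n, Q != 0 & forall (u v : 'cV[F]_n) tau,
    tau != 0 -> v^T *m Q *m u != 0 ->
    jordan_sizes (A + tau *: (u *m v^T)) l s.
Proof.
case=> bs jA bsl sorted_s; set N := A - l%:M.
have size_le : all (geq m) s.
  by apply: order_path_min sorted_s => // y x z /= xy yz; apply: leq_trans yz xy.
have pos_sizes M cs :
    has_jordan_form M cs -> all (ltn 0) [seq b.1 | b <- cs & b.2 == l].
  case=> cs0 _; rewrite all_map; apply/allP => b; rewrite mem_filter => /andP [_ bcs].
  exact: (allP cs0).
have /andP [/= m0 s0] : all (ltn 0) (m :: s).
  by rewrite -(perm_all _ bsl); apply: pos_sizes jA.
have rankN p : (\rank (N ^+ p) + (minn p m + \sum_(x <- s) minn p x) = n)%N.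
  have := rank_jordan_form l p jA.
  by rewrite -big_filter -(big_map fst predT (minn p)) (perm_big _ bsl) big_cons.
have stab : \rank (N ^+ m.+1) = \rank (N ^+ m).
  have eq_sum : (\sum_(x <- s) minn m.+1 x = \sum_(x <- s) minn m x)%N.
    by rewrite !big_seq; apply: eq_bigr => x /(allP size_le) /=; lia.
  by have := rankN m; have := rankN m.+1; rewrite eq_sum; lia.
have strict : (\rank (N ^+ m.-1.+1) < \rank (N ^+ m.-1))%N.
  have le_sum : (\sum_(x <- s) minn m.-1 x <= \sum_(x <- s) minn m x)%N.
    by apply: leq_sum => x _; rewrite leq_min geq_minr (leq_trans (geq_minl _ _)) ?leq_pred.
  by rewrite prednK //; have := rankN m; have := rankN m.-1; lia.
have [e eN eN0] := ker_exp_strict strict.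
have [G [GN GNd Gid]] := fitting_projection stab.
exists (G *m N ^+ m.-1) => [|u v tau tau0 uv].
  apply: contraNneq eN0 => Q0; rewrite prednK // in eN.
  by rewrite -[X in X *m _](Gid _ e eN) -mulmxA Q0 mulmx0.
set M := A + _; have [cs jM] := jordan_form_exists M; exists cs => //.
apply: perm_eq_sum_minn => [||p] //; first exact: pos_sizes jM.
have := rank_jordan_form l p jM.
rewrite -big_filter -(big_map fst predT (minn p)) /M addrAC.
rewrite (rank_perturbed_exp stab GN GNd Gid uv tau0).
by move=> rkM; apply: (@addnI (\rank (N ^+ p) + minn p m)); rewrite rkM -addnA rankN.
Qed.

(** * Genericity *)

Section Genericity.
Variable F : closedFieldType.

(** Along the moment curve w = (1, t, ..., t^(n-1)) the product z w is a
    nonzero polynomial in t, so finitely many of them have a common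
    non-root. *)
Lemma common_nonorthogonal n r (z : 'I_r -> 'rV[F]_n) : (forall j, z j != 0) ->
  exists w : 'cV[F]_n, forall j, z j *m w != 0.
Proof.
move=> z0; have [|t] := closed_nonrootP (\prod_j rVpoly (z j)) _.
  apply/prodf_neq0 => j _; apply: contra (z0 j) => /eqP zj.
  by rewrite -[z j]rVpolyK zj raddf0.
rewrite rootE horner_prod => /prodf_neq0 nz; exists (\col_i t ^+ i) => j.
apply: contra (nz j isT) => /eqP/matrixP/(_ 0 0); rewrite !mxE => zt.
rewrite (horner_coef_wide _ (size_poly _ _)) -[X in _ == X]zt.
apply/eqP; apply: eq_bigr => i _.
by rewrite coef_rVpoly_ord mxE.
Qed.

Lemma common_nonvanishing n r (Q : 'I_r -> 'M[F]_n) : (forall j, Q j != 0) ->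
  exists u v : 'cV[F]_n, forall j, v^T *m Q j *m u != 0.
Proof.
move=> Q0; have rowQ j : exists i, row i (Q j) != 0.
  have : ~~ (Q j <= (0 : 'M_n))%MS by rewrite submx0.
  by case/row_subPn => i; rewrite submx0; exists i.
have [w wrow] := fin_all_exists rowQ.
have [u uQ] := common_nonorthogonal wrow.
have Qu j : (Q j *m u)^T != 0.
  by apply: contra (uQ j); rewrite trmx_eq0 -row_mul => /eqP ->; rewrite row0.
have [v vQ] := common_nonorthogonal Qu; exists u, v => j.
apply: contra (vQ j) => /eqP vQu.
by rewrite -trmx_eq0 trmx_mul trmxK mulmxA vQu eqxx.
Qed.

Lemma generic_nonvanishing n r (Q : 'I_r -> 'M[F]_n) : (forall j, Q j != 0) ->
  generic (fun x : 'cV[F]_(n + n) =>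
    forall j, (dsubmx x)^T *m Q j *m usubmx x != 0).
Proof.
move=> Q0; pose f j : {mpoly F[n + n]} :=
  \sum_(a < n) \sum_(b < n) Q j a b *: ('X_(rshift n a) * 'X_(lshift n b)).
have fE j (x : 'cV[F]_(n + n)) :
    (f j).@[fun i => x i 0] = ((dsubmx x)^T *m Q j *m usubmx x) 0 0.
  rewrite /f exchange_big raddf_sum mxE; apply: eq_bigr => b _.
  rewrite raddf_sum mxE mulr_suml; apply: eq_bigr => a _.
  by rewrite /= mevalZ mevalM !mevalXU !mxE mulrCA mulrA.
have evalP (x : 'cV[F]_(n + n)) : (\prod_j f j).@[fun i => x i 0] != 0
    <-> forall j, (dsubmx x)^T *m Q j *m usubmx x != 0.
  rewrite rmorph_prod; split=> [/prodf_neq0 nz j|nz].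
    by apply: contra (nz j isT) => /eqP xj; rewrite /= fE xj mxE.
  apply/prodf_neq0 => j _; rewrite /= fE; apply: contra (nz j) => /eqP xj.
  by rewrite [X in X == 0]mx11_scalar xj raddf0.
have [u [v uv]] := common_nonvanishing Q0.
have nz_uv j : (dsubmx (col_mx u v))^T *m Q j *m usubmx (col_mx u v) != 0.
  by rewrite col_mxKd col_mxKu.
split; first by exists (col_mx u v).
exists (fun x => (\prod_j f j).@[fun i => x i 0] = 0); split.
- exists [:: \prod_j f j] => x; split=> [x0 p|]; last by apply; rewrite mem_head.
  by rewrite inE => /eqP ->.
- by exists (col_mx u v); apply/eqP/evalP.
- by move=> x nO; apply/eqP; apply: contraT => /evalP.
Qed.

End Genericity.

Theorem theorem3p1 (R : realType) (n : nat) (A : 'M[R[i]]_n)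
  (r : nat) (lambda : 'I_r -> R[i]) (ns : 'I_r -> seq nat)
  (lambda_inj : injective lambda)
  (ns_nonempty : forall j, ns j != [::])
  (ns_sorted : forall j, sorted geq (ns j))
  (A_jordan : has_jordan_form A
     (flatten [seq [seq (m, lambda j) | m <- ns j] | j <- enum 'I_r])) :
  exists Omega : 'cV[R[i]]_(n + n) -> Prop,
    generic Omega /\
    forall u v : 'cV[R[i]]_n, Omega (col_mx u v) ->
    forall tau : R[i], tau != 0 ->
    forall j : 'I_r,
      jordan_sizes (A + tau *: (u *m v^T)) (lambda j) (behead (ns j)) /\
      (size (ns j) = 1%N ->
       ~~ eigenvalue (A + tau *: (u *m v^T)) (lambda j)).
Proof.
have sizesA j : jordan_sizes A (lambda j) (ns j).
  eexists; first exact: A_jordan.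
  rewrite filter_flatten map_flatten -!map_comp.
  suff /eq_map -> : (fun k => [seq b.1 |
      b <- [seq b <- [seq (m, lambda k) | m <- ns k] | b.2 == lambda j]])
     =1 (fun k => if k == j then ns j else [::]).
    apply/seq.permP => a; rewrite count_flatten -map_comp sumnE big_map -enumT big_enum /=.
    by rewrite (bigD1 j) //= eqxx big1 ?addn0 // => k /negPf ->.
  move=> k /=; rewrite filter_map -map_comp /= map_id_in //.
  have [->|kj] := eqVneq k j.
    by rewrite (eq_filter (a2 := predT)) ?filter_predT // => m /=; rewrite eqxx.
  rewrite (eq_filter (a2 := pred0)) ?filter_pred0 // => m /=.
  by rewrite (inj_eq lambda_inj) (negPf kj).
have ex_form j : exists Q : 'M[R[i]]_n,
    Q != 0 /\ forall (u v : 'cV[R[i]]_n) tau, tau != 0 ->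
    v^T *m Q *m u != 0 ->
    jordan_sizes (A + tau *: (u *m v^T)) (lambda j) (behead (ns j)).
  move: (sizesA j) (ns_sorted j) (ns_nonempty j); case: (ns j) => // m s sA srt _.
  by have [Q Q0 HQ] := perturbed_jordan_sizes sA srt; exists Q.
have [Q HQ] := fin_all_exists ex_form.
exists (fun x => forall j, (dsubmx x)^T *m Q j *m usubmx x != 0); split.
  by apply: generic_nonvanishing => j; case: (HQ j).
move=> u v uv tau tau0 j; have [_ sizesB] := HQ j.
have := uv j; rewrite col_mxKd col_mxKu => /(sizesB _ _ _ tau0) sizes; split=> // size1.
apply: jordan_sizes_nil_eigenvalue; move: sizes.
by case: (ns j) size1 => [|m []].
Qed.
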